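(* If $G$ is a connected unicyclic graph, then $D(G)=\dim(G)+1$ if and only if $G$ is isomorphic to one of $C_3$, $C_4$, $C_5$.
   Context: All graphs are finite and simple; a unicyclic graph is a graph containing exactly one cycle; $C_m$ is the cycle on $m$ vertices. For a connected graph $G$ with shortest-path distance $d_G$, a set $S\subseteq V(G)$ is resolving if for any two distinct vertices $x,y$ there is $s\in S$ with $d_G(x,s)\neq d_G(y,s)$; the metric dimension $\dim(G)$ is the minimum size of a resolving set. A distinguishing coloring of a graph $G$ is a (not necessarily proper) vertex coloring such that the only automorphism of $G$ mapping every vertex to a vertex of the same color is the identity; the distinguishing number $D(G)$ is the minimum number of colors in a distinguishing coloring of $G$. *)

(* Defs.v *)
(* A finite simple graph is a symmetric irreflexive
   relation e : rel T on a finType T. *)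
From mathcomp Require Import all_boot fingroup perm.
Set Implicit Arguments. Unset Strict Implicit. Unset Printing Implicit Defensive.

Section Graphs.
Variable T : finType.
Implicit Types (e : rel T).

Definition gconnected e : Prop := forall x y : T, connect e x y.

Definition walk_of_len e (x y : T) (n : nat) : bool :=
  [exists p : n.-tuple T, path e x p && (last x p == y)].

(* shortest-path distance d_G(x,y): least n with a walk of length n
   (shortest walks are paths; in a connected graph this is < #|T|) *)
Definition gdist e (x y : T) : nat :=
  find (walk_of_len e x y) (iota 0 #|T|).

Definition resolving e (S : {set T}) : bool :=
  [forall x, forall y, (x != y) ==> [exists s in S, gdist e x s != gdist e y s]].

Definition metric_dim e : nat :=
  find (fun k => [exists S : {set T}, (#|S| == k) && resolving e S]) (iota 0 #|T|.+1).

Definition gaut e (f : {perm T}) : bool :=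
  [forall x, forall y, e (f x) (f y) == e x y].

Definition distinguishing e (C : eqType) (c : T -> C) : bool :=
  [forall f : {perm T}, (gaut e f && [forall x, c (f x) == c x]) ==> (f == 1%g)].

Definition dist_number e : nat :=
  find (fun k => [exists c : {ffun T -> 'I_k}, distinguishing e c]) (iota 0 #|T|.+1).

(* cycles of the graph: a sequence of >= 3 distinct vertices, consecutive
   ones adjacent, last adjacent to first.  The cycle (as a subgraph) is
   determined by its edge set. *)
Definition is_cycle_seq e (s : seq T) : bool :=
  [&& uniq s, 3 <= size s & path.cycle e s].

Definition cycle_edges (s : seq T) : {set T * T} :=
  [set p : T * T | (p.1 \in s) && ((p.2 == next s p.1) || (p.1 == next s p.2))].

Definition unicyclic e : Prop :=
  (exists s, is_cycle_seq e s) /\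
  (forall s t, is_cycle_seq e s -> is_cycle_seq e t -> cycle_edges s = cycle_edges t).

End Graphs.

Definition gisomorphic (T1 T2 : finType) (e1 : rel T1) (e2 : rel T2) : Prop :=
  exists f : T1 -> T2, bijective f /\ forall x y, e2 (f x) (f y) = e1 x y.

Definition cycle_graph (m : nat) : rel 'I_m :=
  fun i j => (val j == i.+1 %% m) || (val i == j.+1 %% m).
Arguments cycle_graph m : clear implicits.

(* Main.v *)
(* Let [S] be a minimum resolving set.  Every vertex hangs in a tree at a unique
   cycle vertex (its projection), and the two cycle neighbours of [a] are
   equidistant from everything in the tree at [a]; so no single tree contains
   [S].  Use [S] itself as the set of colours: off the cycle a vertex of [S] gets
   its own colour, and any other vertex of the tree at [a] a colour of [S] lying
   outside that tree.  A colour-preserving automorphism that fixes an edge of the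
   cycle pointwise then fixes [S], hence is trivial, whatever the colours on the
   cycle.  With three colours one marks the ends of a cycle edge differently.
   With two colours one marks the ends of a cycle edge [ab] alike and breaks the
   swap: either exactly one of the two trees is trivial, or all trees are
   nontrivial and the one at [a] misses [S], hence may be coloured by either
   colour.  If [G] is a cycle of length at least 6, the vertices 0, 1, 3 are
   marked.  Conversely a cycle of length at most 5 has dimension 2, and each of
   its 2-colourings is invariant under a reflection. *)
Require Import Defs.
From mathcomp Require Import all_boot fingroup perm.
From mathcomp Require Import zify.
Set Implicit Arguments. Unset Strict Implicit. Unset Printing Implicit Defensive.

(** * Searching for the least number with a property *)

Lemma find_iota_le (P : pred nat) n N : P n -> find P (iota 0 N) <= n.
Proof.
move=> Pn; case: (ltnP n N) => [ltnN|leNn].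
  by rewrite leqNgt; apply/negP => /(before_find 0); rewrite nth_iota // Pn.
by apply: leq_trans leNn; rewrite -{2}(size_iota 0 N) find_size.
Qed.

Lemma find_iotaP (P : pred nat) n N : P n -> n < N -> P (find P (iota 0 N)).
Proof.
move=> Pn ltnN; have hasP : has P (iota 0 N).
  by apply/hasP; exists n; rewrite ?mem_iota.
have := nth_find 0 hasP; rewrite nth_iota //.
by have := hasP; rewrite has_find size_iota.
Qed.

(** * Distances, resolving sets and distinguishing colourings *)

Section Distance.
Variables (T : finType) (e : rel T).
Implicit Types (x y : T) (S : {set T}) (f : {perm T}).

Lemma walkP x y n :
  reflect (exists p, [/\ path e x p, last x p = y & size p = n])
          (walk_of_len e x y n).
Proof.
apply: (iffP existsP) => [[p /andP[ep /eqP lp]]|[p [ep lp sp]]].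
  by exists p; rewrite size_tuple.
by exists (tcast sp (in_tuple p)); rewrite val_tcast ep lp eqxx.
Qed.

Lemma gdist_le x p : path e x p -> gdist e x (last x p) <= size p.
Proof. by move=> ep; apply: find_iota_le; apply/walkP; exists p. Qed.

(** A walk shortened to a repetition-free path has length below [#|T|], within the range that
    [gdist] searches. *)
Lemma gdist_walk x y :
  connect e x y -> exists p, [/\ path e x p, last x p = y & size p = gdist e x y].
Proof.
move=> /connectP[p ep ->]; case: (shortenP ep) => q eq uq _.
apply/walkP; apply: (@find_iotaP _ (size q)); first by apply/walkP; exists q.
by rewrite -[_.+1]/(size (x :: q)) -(card_uniqP uq) max_card.
Qed.

Lemma gdist_eq0 x y : connect e x y -> (gdist e x y == 0) = (x == y).
Proof.
move=> /gdist_walk[p [ep lp sp]]; apply/eqP/eqP => [d0|->].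
  by move: sp lp; rewrite d0 => /size0nil->.
by apply/eqP; rewrite -leqn0; apply: (@gdist_le y [::]).
Qed.

Lemma gdist_eq1 x y : connect e x y -> x != y -> (gdist e x y == 1) = e x y.
Proof.
move=> cxy nxy; apply/eqP/idP => [d1|exy].
  have [p [+ + sp]] := gdist_walk cxy; move: sp; rewrite d1.
  by case: p => [|z []] //= _; rewrite andbT => + <-.
apply/eqP; rewrite eqn_leq lt0n gdist_eq0 // nxy andbT.
by apply: (@gdist_le x [:: y]); rewrite /= exy.
Qed.

Lemma gautE f : gaut e f -> forall x y, e (f x) (f y) = e x y.
Proof. by move=> /forallP h x y; apply/eqP; move/forallP: (h x). Qed.

Lemma gautV f : gaut e f -> gaut e f^-1%g.
Proof.
move=> /gautE h; apply/forallP => x; apply/forallP => y.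
by rewrite -h !permKV.
Qed.

Hypothesis e_conn : gconnected e.

Lemma gdist_aut f x y : gaut e f -> gdist e (f x) (f y) = gdist e x y.
Proof.
have le g u v : gaut e g -> gdist e (g u) (g v) <= gdist e u v.
  move=> /gautE ag; have [p [ep <- <-]] := gdist_walk (e_conn u v).
  rewrite -(size_map g) -last_map gdist_le //.
  by rewrite path_map (eq_path (e' := e)).
move=> af; apply/eqP; rewrite eqn_leq le //=.
by have := le _ (f x) (f y) (gautV af); rewrite !permK.
Qed.

Lemma resolvingP S :
  reflect (forall x y, (forall s, s \in S -> gdist e x s = gdist e y s) -> x = y)
          (resolving e S).
Proof.
apply: (iffP idP) => [/forallP h x y exy|h].
  have /forallP/(_ y)/implyP hxy := h x; apply/eqP/negPn/negP.
  by move=> /hxy /existsP[s /andP[sS]]; rewrite exy ?eqxx.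
apply/forallP => x; apply/forallP => y; apply/implyP; apply: contraNT => nex.
apply/eqP/h => s sS; apply/eqP; apply: contraNT nex => ne.
by apply/existsP; exists s; rewrite sS.
Qed.

Lemma metric_dimP : exists2 S : {set T}, #|S| = metric_dim e & resolving e S.
Proof.
pose P k := [exists S : {set T}, (#|S| == k) && resolving e S].
have: P (find P (iota 0 #|T|.+1)).
  apply: (@find_iotaP _ #|T|) => //; apply/existsP; exists setT.
  rewrite cardsT eqxx; apply/resolvingP => x y exy; apply/eqP.
  by rewrite -gdist_eq0 // exy ?inE // gdist_eq0.
by move=> /existsP[S /andP[/eqP cS rS]]; exists S.
Qed.

Lemma metric_dim_le S : resolving e S -> metric_dim e <= #|S|.
Proof.
by move=> rS; apply: find_iota_le; apply/existsP; exists S; rewrite eqxx.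
Qed.

Lemma distinguishingP (C : eqType) (c : T -> C) :
  reflect (forall f, gaut e f -> (forall x, c (f x) = c x) -> f = 1%g)
          (distinguishing e c).
Proof.
apply: (iffP idP) => [/forallP h f af cf|h].
  by apply/eqP; apply: (implyP (h f)); rewrite af; apply/forallP => x; rewrite cf.
apply/forallP => f; apply/implyP => /andP[af /forallP cf]; apply/eqP/h => // x.
exact/eqP.
Qed.

(** Allows any finite set of colours; they are renumbered by their rank in [A]. *)
Lemma dist_number_le (U : finType) (A : {set U}) (c : T -> U) (x0 : T) :
  (forall x, c x \in A) -> distinguishing e c -> dist_number e <= #|A|.
Proof.
move=> cA /distinguishingP dc; apply: find_iota_le; apply/existsP.
exists [ffun x => enum_rank_in (cA x0) (c x)].
apply/distinguishingP => f af cf; apply: dc => // x; have := cf x.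
by rewrite !ffunE => /enum_rank_in_inj; apply.
Qed.

Lemma resolving_fix S f :
  resolving e S -> gaut e f -> (forall s, s \in S -> f s = s) -> f = 1%g.
Proof.
move=> /resolvingP rS af fS; apply/permP => x; rewrite perm1.
by apply: rS => s sS; rewrite -{1}(fS s sS) gdist_aut.
Qed.

(** Each vertex of [S] gets its own colour and all others share [None], so a colour-preserving
    automorphism fixes [S] pointwise. *)
Lemma dist_number_le_metric_dim (x0 : T) : dist_number e <= metric_dim e + 1.
Proof.
have [S <- rS] := metric_dimP.
pose c x := if x \in S then Some x else None.
have -> : #|S| + 1 = #|None |: [set Some x | x in S]|.
  rewrite cardsU1 card_imset; last exact: Some_inj.
  by rewrite addnC; case: imsetP => // -[].
apply: (@dist_number_le _ _ c) => // [x|].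
  by rewrite /c; case: ifP => xS; rewrite !inE // mem_imset //; exact: Some_inj.
apply/distinguishingP => f af cf; apply: (resolving_fix rS) => // x xS.
by have := cf x; rewrite /c xS; case: ifP => // _ [].
Qed.

End Distance.

(** * Adjacency of positions on a cycle *)

Lemma modS_small i n : i < n -> i.+1 %% n = if i.+1 == n then 0 else i.+1.
Proof.
move=> ltin; case: eqP => [->|ne]; rewrite ?modnn // modn_small //.
by rewrite ltn_neqAle ltin andbT; apply/eqP.
Qed.

(** The wrap-around is spelled out without a modulus, in a form [lia] can use. *)
Definition cyclic_adj n i j :=
  [|| j == i.+1, i == j.+1, (i.+1 == n) && (j == 0) | (j.+1 == n) && (i == 0)].

Lemma cyclic_adjE n i j : 1 < n -> i < n -> j < n ->
  (j == i.+1 %% n) || (i == j.+1 %% n) = cyclic_adj n i j.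
Proof.
move=> n1 ltin ltjn; rewrite !modS_small // /cyclic_adj.
by case: (i.+1 =P n); case: (j.+1 =P n); lia.
Qed.

Lemma cycle_graphE n (i j : 'I_n) : 1 < n -> cycle_graph n i j = cyclic_adj n i j.
Proof. by move=> n1; apply: (cyclic_adjE n1 (ltn_ord i) (ltn_ord j)). Qed.

(** Among 0, 1, 3 only 0 and 1 are adjacent. A path starting 1, 0 would continue to [n - 1] and
    [n - 2], and [n - 2] is at least 4, hence not in the list. *)
Lemma cyclic_rigid n i0 i1 i2 i3 : 5 < n ->
  {subset [:: i0; i1; i3] <= [:: 0; 1; 3]} -> uniq [:: i0; i1; i2; i3] ->
  cyclic_adj n i0 i1 -> cyclic_adj n i1 i2 -> cyclic_adj n i2 i3 ->
  i0 = 0 /\ i1 = 1.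
Proof.
move=> n6 c; have := c i0; have := c i1; have := c i3.
rewrite /= !inE !eqxx !orbT /= => /(_ isT) c3 /(_ isT) c1 /(_ isT) c0.
case/or3P: c0 => /eqP->; case/or3P: c1 => /eqP->; case/or3P: c3 => /eqP->;
  rewrite /cyclic_adj; lia.
Qed.

Lemma index_next (T : eqType) (s : seq T) x : uniq s -> x \in s ->
  index (next s x) s = (index x s).+1 %% size s.
Proof.
move=> us xs; rewrite next_nth xs; case: s us xs => // y p us xs.
rewrite modS_small ?index_mem //; move: xs; rewrite -index_mem.
move: (index x _) => i; rewrite ltnS => lei; rewrite eqSS.
case: eqP => [->|ne]; first by rewrite nth_default //= eqxx.
have lti : i < size p by rewrite ltn_neqAle; apply/andP; split=> //; apply/eqP.
by rewrite -(@index_uniq _ y i.+1 (y :: p)).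
Qed.

(** * The cycle and the trees attached to it *)

Section Unicyclic.
Variables (T : finType) (e : rel T) (s : seq T).
Hypotheses (e_sym : symmetric e) (e_irr : irreflexive e) (e_conn : gconnected e).
Hypothesis cycle_s : is_cycle_seq e s.
Hypothesis s_unique : forall t, is_cycle_seq e t -> cycle_edges t = cycle_edges s.
Implicit Types (x y a b : T) (f : {perm T}) (S : {set T}).

Definition cedge x y := (x, y) \in cycle_edges s.
Definition tedge x y := e x y && ~~ cedge x y.

Let uniq_s : uniq s. Proof. by have /and3P[] := cycle_s. Qed.
Let size_s : 2 < size s. Proof. by have /and3P[] := cycle_s. Qed.

Lemma cedgeE x y : cedge x y = (x \in s) && ((y == next s x) || (x == next s y)).
Proof. by rewrite /cedge inE. Qed.

Lemma cedge_next x : x \in s -> cedge x (next s x).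
Proof. by rewrite cedgeE => ->; rewrite eqxx. Qed.

Lemma cedge_mem x y : cedge x y -> (x \in s) && (y \in s).
Proof.
rewrite cedgeE => /andP[xs]; rewrite xs => /orP[/eqP->|/eqP xy] /=.
  by rewrite mem_next.
by rewrite -mem_next -xy.
Qed.

Lemma cedge_sym : symmetric cedge.
Proof.
by move=> x y; apply/idP/idP => /[dup] /cedge_mem/andP[xs ys];
  rewrite !cedgeE xs ys orbC.
Qed.

Lemma cedge_sub x y : cedge x y -> e x y.
Proof.
have en u : u \in s -> e u (next s u).
  by move=> us; apply: next_cycle us; have /and3P[] := cycle_s.
move=> /[dup] /cedge_mem/andP[xs ys]; rewrite cedgeE => /andP[_].
by case/orP => /eqP->; [|rewrite e_sym]; apply: en.
Qed.

Lemma cedge_connect x y : x \in s -> y \in s -> connect cedge x y.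
Proof.
by apply: connect_cycle; apply: cycle_from_next => // u; apply: cedge_next.
Qed.

Lemma cedge_index x y : x \in s -> y \in s ->
  cedge x y = cyclic_adj (size s) (index x s) (index y s).
Proof.
have idx u v : u \in s -> v \in s ->
    (u == next s v) = (index u s == (index v s).+1 %% size s).
  move=> us vs; rewrite -index_next //; apply/eqP/eqP => [->//|].
  by apply: index_inj; rewrite // mem_next.
by move=> xs ys; rewrite cedgeE xs !idx // cyclic_adjE ?index_mem // ltnW.
Qed.

Lemma next_next_neq x : x \in s -> next s (next s x) != x.
Proof.
move=> xs; apply/eqP => /(congr1 (index^~ s)).
rewrite !index_next ?mem_next //; move: xs size_s; rewrite -index_mem.
move: (index x s) (size s) => i n lti ltn; rewrite [i.+1 %% n]modS_small //.
by case: eqP => ni; rewrite modS_small; try case: eqP; lia.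
Qed.

(* Closing a path that avoids the edge [xy] would give a second cycle. *)
Lemma tedge_bridge x y : tedge x y ->
  ~~ connect (fun u v => e u v && ~~ ((u == x) && (v == y) || (u == y) && (v == x))) y x.
Proof.
case/andP=> exy ncxy; apply/negP => /connectP[p0 ep0 xp0].
move: xp0; case: (shortenP ep0) => p ep up _ xp.
have ep' : path e y p by apply: sub_path ep => u v /andP[].
have ct : is_cycle_seq e (y :: p).
  apply/and3P; split=> //; last by rewrite /= rcons_path ep' -xp exy.
  move: ep xp exy; case: p {ep0 up ep'} => [|z [|//]] /=.
    by move=> _ ->; rewrite e_irr.
  by move=> /[swap] ->; rewrite !eqxx orbT andbF.
have nx : next (y :: p) x = y.
  by rewrite next_nth {1}xp mem_last xp index_last // nth_default.
case/negP: ncxy; rewrite /cedge -(s_unique ct) inE; apply/andP; split.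
  by rewrite xp; apply: mem_last.
by apply/orP; left; apply/eqP/esym.
Qed.

(** Otherwise the first edge of a simple tree path from [a] to [b] is no bridge: its ends stay
    connected through the rest of the path, which avoids [a], and then along the cycle. *)
Lemma tedge_cycle_eq a b : a \in s -> b \in s -> connect tedge a b -> a = b.
Proof.
move=> As bs /connectP[p0 ep0 bp0].
move: bp0; case: (shortenP ep0) => -[//|x p] /= /andP[tax ep] /andP[ap up] _ bp.
case/negP: (tedge_bridge tax); apply: (@connect_trans _ _ b).
  apply/connectP; exists p => //.
  have xpa : all (predC1 a) (x :: p).
    by apply/allP => u up'; apply: contraNneq ap => <-.
  apply: sub_in_path xpa ep => u v /negbTE ua /negbTE va /andP[euv _].
  by rewrite euv ua va andbF.
apply: connect_sub (cedge_connect bs As) => u v cuv; apply: connect1.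
rewrite cedge_sub //=; apply/negP => /orP[]/andP[/eqP uu /eqP vv]; case/andP: tax => _.
  by rewrite -uu -vv cuv.
by rewrite -uu -vv cedge_sym cuv.
Qed.

Lemma tedge_sym : symmetric tedge.
Proof. by move=> x y; rewrite /tedge e_sym cedge_sym. Qed.


(** The root on the cycle of the tree containing [x]; it exists by [projP] and is unique by
    [tedge_cycle_eq]. *)
Definition proj x := odflt x [pick a in s | connect tedge x a].

(** If no cycle vertex were reachable from [x] by tree edges, the first edge of a walk towards the
    cycle would be a tree edge, and its end would inherit the defect; at the end of the walk this is
    absurd. *)
Lemma projP x : proj x \in s /\ connect tedge x (proj x).
Proof.
rewrite /proj; case: pickP => [a /andP[]//|no]; exfalso.
have /hasP[a sa _] : has predT s by rewrite has_predT; lia.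
have /connectP[p] := e_conn x a; elim: p x no => [|y p IH] x no /=.
  by move=> _ ax; have := no x; rewrite connect0 -ax sa.
case/andP=> exy ep ap; apply: (IH y) ap => // b; have := no b; rewrite /=.
case: (b \in s) => //=; apply: contraFF; apply/connect_trans/connect1.
rewrite /tedge exy /=; apply/negP => /cedge_mem/andP[xs _].
by have := no x; rewrite /= xs connect0.
Qed.

Lemma proj_eq x a : a \in s -> connect tedge x a -> proj x = a.
Proof.
move=> sa xa; have [ps xp] := projP x; apply: tedge_cycle_eq => //.
by apply: connect_trans xa; rewrite (sym_connect_sym tedge_sym).
Qed.

Lemma proj_id a : a \in s -> proj a = a.
Proof. by move=> sa; apply: proj_eq. Qed.

Lemma proj_edge x y : e x y -> ~~ cedge x y -> proj x = proj y.
Proof.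
move=> exy cxy; have [ps yp] := projP y; apply: proj_eq => //.
by apply: connect_trans yp; apply: connect1; rewrite /tedge exy.
Qed.

(** A chord would be a tree edge, so its ends, each its own projection, would coincide. *)
Lemma edge_cedge x y : e x y -> x \in s -> y \in s -> cedge x y.
Proof.
move=> exy xs ys; apply/negPn/negP => /(proj_edge exy).
by rewrite !proj_id // => xy; rewrite xy e_irr in exy.
Qed.

(** The projection changes only along cycle edges, so a walk can enter the tree at [a] only through
    [a] itself. *)
Lemma path_proj x p a : path e x p -> proj x != a -> proj (last x p) = a ->
  exists p1 p2, p = p1 ++ a :: p2.
Proof.
elim: p x => [|y p IH] x /=; first by move=> _ /eqP.
case/andP=> exy ep xa la; have [ya|ya] := eqVneq (proj y) a; last first.
  by have [p1 [p2 ->]] := IH y ep ya la; exists (y :: p1), p2.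
have /cedge_mem/andP[_ ys] : cedge x y.
  by apply/negPn/negP => /(proj_edge exy) xy; rewrite xy ya eqxx in xa.
by exists [::], p; rewrite -ya proj_id.
Qed.

(** A shortest walk from [y] to [z] visits [a]; replacing its part before [a] by the edge from [x]
    does not lengthen it. *)
Lemma gdist_branch a x y z : cedge x a -> cedge y a -> proj z = a ->
  gdist e x z <= gdist e y z.
Proof.
move=> xa ya za; have [p [ep lp <-]] := gdist_walk (e_conn y z).
have /andP[ys sa] := cedge_mem ya.
have pya : proj y != a.
  by rewrite proj_id //; apply: contraTneq (cedge_sub ya) => ->; rewrite e_irr.
have pl : proj (last y p) = a by rewrite lp.
have [p1 [p2 dp]] := path_proj ep pya pl.
move: ep; rewrite dp cat_path /= => /and3P[_ _ ep2].
have <- : last x (a :: p2) = z by rewrite -lp dp last_cat.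
apply: leq_trans (gdist_le _) _; first by rewrite /= cedge_sub.
by rewrite size_cat leq_addl.
Qed.

(* The two neighbours of [a] on the cycle are equidistant from every vertex
   of the tree at [a]. *)
Lemma resolving_proj S a : resolving e S -> a \in s ->
  exists2 x, x \in S & proj x != a.
Proof.
move=> /resolvingP rS sa.
case: (pickP [pred x in S | proj x != a]) => [x /andP[]|no]; first by exists x.
exfalso.
have: next s a = prev s a.
  apply: rS => z zS; have := no z; rewrite /= zS => /negbFE/eqP za.
  have na : cedge (next s a) a by rewrite cedge_sym cedge_next.
  have pa : cedge (prev s a) a.
    by rewrite -{2}(next_prev uniq_s a) cedge_next ?mem_prev.
  by apply/eqP; rewrite eqn_leq !(@gdist_branch a).
by move=> np; have := next_next_neq sa; rewrite np next_prev // eqxx.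
Qed.

(** * Automorphisms, the cycle and projections *)

Section Automorphism.
Variable f : {perm T}.
Hypothesis f_aut : gaut e f.

Let f_inj : injective f := @perm_inj _ f.

(** The image of [s] is again a cycle, so by uniqueness it has the same edges. *)
Lemma aut_cedge x y : cedge (f x) (f y) = cedge x y.
Proof.
have ct : is_cycle_seq e (map f s).
  have /and3P[us ss cs] := cycle_s; apply/and3P; split.
  - by rewrite map_inj_uniq.
  - by rewrite size_map.
  - by rewrite cycle_map (eq_cycle (e' := e)) // => u v; apply: gautE.
rewrite {1}/cedge -(s_unique ct) cedgeE inE -[(f x, f y).1]/(f x) -[(f x, f y).2]/(f y).
by rewrite mem_map // !next_map // !(inj_eq f_inj).
Qed.

End Automorphism.

Lemma aut_mem_cycle f x : gaut e f -> (f x \in s) = (x \in s).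
Proof.
have imp g u : gaut e g -> u \in s -> g u \in s.
  move=> ag us; have : cedge (g u) (g (next s u)) by rewrite aut_cedge // cedge_next.
  by case/cedge_mem/andP.
move=> af; apply/idP/idP; last exact: imp.
by move/(imp _ _ (gautV af)); rewrite permK.
Qed.

Lemma aut_proj f x : gaut e f -> proj (f x) = f (proj x).
Proof.
move=> af; have [ps /connectP[p ep lp]] := projP x.
apply: proj_eq; first by rewrite aut_mem_cycle.
apply/connectP; exists (map f p); last by rewrite last_map -lp.
rewrite path_map; apply: sub_path ep => u v.
by rewrite /tedge /= (gautE af) aut_cedge.
Qed.

(** Two consecutive fixed vertices force the next one to be fixed, and so on around the cycle. *)
Lemma aut_fix_cycle f a b : gaut e f -> cedge a b -> f a = a -> f b = b ->
  forall x, x \in s -> f x = x.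
Proof.
move=> af; wlog -> : a b / b = next s a => [IH|] cab fa fb x xs.
  have [a_s bs] := andP (cedge_mem cab).
  have := cab; rewrite cedgeE a_s /= => /orP[]/eqP h; first exact: (IH a b).
  by apply: (IH b a) => //; rewrite cedge_sym.
have [a_s _] := andP (cedge_mem cab).
have next_in u i : u \in s -> iter i (next s) u \in s.
  by move=> us; elim: i => //= i; rewrite mem_next.
have fixn i : f (iter i (next s) a) = iter i (next s) a /\
              f (iter i.+1 (next s) a) = iter i.+1 (next s) a.
  elim: i => [|i [f1 f2]]; first by [].
  split=> //; move: f1 f2; rewrite !iterS.
  move: (iter i _ a) (next_in a i a_s) => u us fu fnu.
  (* The image is a cycle neighbour of [next s u]; the neighbour [u] is excluded because it is
     already the image of [u]. *)
  have : cedge (next s u) (f (next s (next s u))).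
    by rewrite -{1}fnu aut_cedge // cedge_next // mem_next.
  rewrite cedgeE mem_next us /= => /orP[/eqP //|/eqP/(can_inj (prev_next uniq_s)) uf].
  have := next_next_neq us; rewrite -(inj_eq (@perm_inj _ f)) -uf fu eqxx.
  by [].
have : fconnect (next s) a x.
  by apply: connect_cycle xs => //; apply: cycle_next.
by move/iter_findex <-; have [] := fixn (findex (next s) a x).
Qed.

Lemma next_neq x : x \in s -> next s x != x.
Proof.
by move=> xs; apply: contraNneq (next_next_neq xs) => nx; rewrite !nx.
Qed.

(** * Colourings with a resolving set as palette *)

Section Colouring.
Variables (S : {set T}) (g m : T -> T).
Hypothesis S_res : resolving e S.
Hypothesis gS : forall x, g x \in S.
Hypothesis mS : forall x, m x \in S.
Hypothesis m_proj : forall a, a \in s -> proj (m a) != a.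

(* The colour [m a] belongs to a vertex of [S] outside the tree at [a], so
   inside that tree the vertices of [S] have unshared colours. *)
Definition colour x :=
  if x \in s then g x else if x \in S then x else m (proj x).

(** Such an [f] maps each tree to itself, and inside a tree the colour of an off-cycle vertex of [S]
    occurs only once off the cycle; so [f] fixes [S]. *)
Lemma colour_fix f : gaut e f -> (forall x, colour (f x) = colour x) ->
  (forall x, x \in s -> f x = x) -> f = 1%g.
Proof.
move=> af cf fs; apply: (resolving_fix e_conn S_res af) => x xS.
have [xs|xs] := boolP (x \in s); first exact: fs.
have pfx : proj (f x) = proj x by rewrite aut_proj // fs //; case: (projP x).
have := cf x; rewrite /colour aut_mem_cycle // (negbTE xs) xS; case: ifP => // _.
by rewrite pfx => mx; have := m_proj (proj1 (projP x)); rewrite mx eqxx.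
Qed.

(** Invariance is split in two: on the cycle only [g] matters, while the off-cycle part serves the
    case where all trees are nontrivial. *)
Lemma colour_dist_number :
  (forall f, gaut e f -> (forall x, x \in s -> g (f x) = g x) ->
     (forall x, x \notin s -> colour (f x) = colour x) ->
     exists a b, [/\ cedge a b, f a = a & f b = b]) ->
  dist_number e <= #|S|.
Proof.
move=> h; have /hasP[x0 _ _] : has predT s by rewrite has_predT; lia.
apply: (@dist_number_le _ _ _ _ colour x0) => [x|].
  by rewrite /colour; case: ifP => // _; case: ifP.
apply/distinguishingP => f af cf.
have gf x : x \in s -> g (f x) = g x.
  by move=> xs; have := cf x; rewrite /colour aut_mem_cycle // xs.
have [a [b [cab fa fb]]] := h f af gf (fun x _ => cf x).
by apply: (colour_fix af cf); apply: (aut_fix_cycle af cab).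
Qed.

End Colouring.

Lemma ex_missing_colour S : resolving e S ->
  exists2 m : T -> T, (forall x, m x \in S) &
                      (forall a, a \in s -> proj (m a) != a).
Proof.
move=> rS; have /hasP[a0 s_a0 _] : has predT s by rewrite has_predT; lia.
have [x0 x0S _] := resolving_proj rS s_a0.
exists (fun a => odflt x0 [pick x in S | proj x != a]) => [a|a sa].
  by case: pickP => [x /andP[]|].
case: pickP => [x /andP[]//|no]; have [x xS xa] := resolving_proj rS sa.
by have := no x; rewrite /= xS xa.
Qed.

(** Applies [resolving_proj] a second time, at the projection of the first vertex found. *)
Lemma resolving_two S : resolving e S ->
  exists x y, [/\ x \in S, y \in S & proj x != proj y].
Proof.
move=> rS; have /hasP[a0 s_a0 _] : has predT s by rewrite has_predT; lia.
have [x xS _] := resolving_proj rS s_a0.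
have [y yS yx] := resolving_proj rS (proj1 (projP x)).
by exists y, x.
Qed.

Lemma metric_dim_ge2 : 2 <= metric_dim e.
Proof.
have [S <- /resolving_two[x [y [xS yS xy]]]] := metric_dimP e_conn.
by apply/card_gt1P; exists x, y; split=> //; apply: contraNneq xy => ->.
Qed.

(** On the cycle, [x] and [y] are each used once, at the two ends of an edge, which is therefore
    fixed. *)
Lemma dist_number_le_three S x y z : resolving e S ->
  x \in S -> y \in S -> z \in S -> x != y -> z != x -> z != y ->
  dist_number e <= #|S|.
Proof.
move=> rS xS yS zS xy zx zy; have [m mS mp] := ex_missing_colour rS.
have /hasP[a sa _] : has predT s by rewrite has_predT; lia.
have sb : next s a \in s by rewrite mem_next.
have ab := next_neq sa.
pose g u := if u == a then x else if u == next s a then y else z.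
have gS u : g u \in S by rewrite /g; do 2!case: ifP => // _.
apply: (colour_dist_number rS gS mS mp) => f af gf _.
exists a, (next s a); split; first exact: cedge_next.
  have := gf a sa; rewrite /g eqxx; case: eqP => // _; case: ifP => _ h.
    by rewrite -h eqxx in xy.
  by rewrite h eqxx in zx.
have := gf _ sb; rewrite /g (negbTE ab) eqxx; case: ifP => _.
  by move=> h; rewrite h eqxx in xy.
by case: eqP => // _ h; rewrite h eqxx in zy.
Qed.

(** For [a] on the cycle: the tree at [a] is trivial, since a cycle vertex is its own projection. *)
Definition bare a := [forall x, (proj x == a) ==> (x \in s)].

Lemma bareP a : reflect (forall x, proj x = a -> x \in s) (bare a).
Proof.
apply: (iffP forallP) => h x; first by move=> xa; apply: (implyP (h x)); apply/eqP.
by apply/implyP => /eqP; apply: h.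
Qed.

Lemma aut_bare f a : gaut e f -> bare (f a) = bare a.
Proof.
have imp g b : gaut e g -> bare b -> bare (g b).
  move=> ag /bareP nb; apply/bareP => x px.
  rewrite -[x](permKV g) aut_mem_cycle //; apply: nb; apply: (@perm_inj _ g).
  by rewrite -aut_proj // permKV.
move=> af; apply/idP/idP; last exact: imp.
by move/(imp _ _ (gautV af)); rewrite permK.
Qed.

(** * Two colours on the cycle *)

Section TwoColours.
Variables (S : {set T}) (x y : T).
Hypothesis S_res : resolving e S.
Hypotheses (xS : x \in S) (yS : y \in S) (pxy : proj x != proj y).

Let xy : x != y. Proof. by apply: contraNneq pxy => ->. Qed.

(** On the cycle only [a] and [b] have colour [x], so [f] fixes both or swaps them; the last premise
    excludes the swap. *)
Lemma dist_number_le_swap m a b : (forall u, m u \in S) ->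
  (forall a, a \in s -> proj (m a) != a) -> cedge a b ->
  (forall f, gaut e f -> 
     (forall u, u \notin s -> 
       colour S (fun u => if u \in [:: a; b] then x else y) m (f u) = 
       colour S (fun u => if u \in [:: a; b] then x else y) m u) ->
     f a = b -> False) ->
  dist_number e <= #|S|.
Proof.
move=> mS mp cab noswap; have /andP[sa sb] := cedge_mem cab.
pose g u := if u \in [:: a; b] then x else y.
have gS u : g u \in S by rewrite /g; case: ifP.
apply: (colour_dist_number S_res gS mS mp) => f af gf cf.
have img u : u \in s -> u \in [:: a; b] -> f u \in [:: a; b].
  move=> us uab; have := gf u us; rewrite /g uab; case: ifP => // _ h.
  by have := xy; rewrite h eqxx.
exists a, b; split=> //; have := img a sa; have := img b sb.
  rewrite !inE !eqxx orbT /= => _ /(_ isT)/orP[/eqP//|/eqP fab].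
  by case: (noswap f).
rewrite !inE !eqxx orbT /= => /(_ isT)/orP[/eqP fba|/eqP//].
move=> /(_ isT)/orP[/eqP faa|/eqP fab].
  by rewrite fba -faa (perm_inj (etrans fba (esym faa))).
by case: (noswap f).
Qed.

Lemma dist_number_le_bare a b : cedge a b -> bare b -> ~~ bare a ->
  dist_number e <= #|S|.
Proof.
move=> cab nb na; have [m mS mp] := ex_missing_colour S_res.
apply: (dist_number_le_swap mS mp cab) => f af _ fab.
by rewrite -(aut_bare a af) fab nb in na.
Qed.

Lemma dist_number_le_dressed : (forall z, z \in S -> z = x \/ z = y) ->
  (forall a, a \in s -> ~~ bare a) -> dist_number e <= #|S|.
Proof.
move=> Sxy nbare; have [m mS mp] := ex_missing_colour S_res.
(* The cycle has at least three vertices, and [proj x], [proj y] account for only two. *)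
have [a sa /andP[ax ay]] : exists2 a, a \in s & (a != proj x) && (a != proj y).
  apply/hasP; apply: contraLR size_s; rewrite -all_predC -leqNgt => /allP h.
  apply: (@uniq_leq_size _ s [:: proj x; proj y]) => // u us.
  by have := h u us; rewrite /= negb_and !negbK !inE.
have sb : next s a \in s by rewrite mem_next.
have [w pw ws] : exists2 w, proj w = next s a & w \notin s.
  move: (nbare _ sb); rewrite negb_forall => /existsP[w].
  by rewrite negb_imply => /andP[/eqP]; exists w.
have ba := next_neq sa.
(* [c0] is the colour of [w], and [z] is one of [x], [y] different from it. *)
pose c0 := if w \in S then w else m (next s a).
pose z := if c0 == x then y else x.
have zS : z \in S by rewrite /z; case: ifP.
have zc0 : z != c0.
  by rewrite /z; case: (eqVneq c0 x) => [->|]; rewrite eq_sym.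
have pz : proj z != a by rewrite /z; case: ifP => _; rewrite eq_sym.
(* The tree at [a] misses [S], so [z] is admissible there; [w] keeps colour [c0] because [next s a]
   differs from [a]. *)
pose m' u := if u == a then z else m u.
have m'S u : m' u \in S by rewrite /m'; case: ifP.
have m'p u : u \in s -> proj (m' u) != u.
  by move=> us; rewrite /m'; case: (u =P a) => [->|_] //; apply: mp.
apply: (dist_number_le_swap m'S m'p (cedge_next sa)) => f af cf fab.
(* The preimage of [w] lies off the cycle in the tree at [a], outside [S], so its colour is [z] and
   not [c0]. *)
pose v := (f^-1%g) w.
have fv : f v = w by rewrite permKV.
have pv : proj v = a.
  by apply: (@perm_inj _ f); rewrite -aut_proj // fv pw fab.
have vs : v \notin s by rewrite -(aut_mem_cycle v af) fv.
have vS : v \notin S.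
  by apply/negP => /Sxy[] vx; move: pv ax ay; rewrite vx => ->; rewrite eqxx.
have := cf v vs; rewrite fv /colour (negbTE ws) (negbTE vs) (negbTE vS) pv pw.
rewrite /m' eqxx (negbTE ba) -/c0 => h.
by rewrite h eqxx in zc0.
Qed.

End TwoColours.

(** * Graphs with a vertex off the cycle, and long cycles *)

Lemma dist_number_le_tree : (exists x, x \notin s) -> dist_number e <= metric_dim e.
Proof.
move=> [v vs]; have [S <- rS] := metric_dimP e_conn.
have [x [y [xS yS pxy]]] := resolving_two rS.
have xy : x != y by apply: contraNneq pxy => ->.
case: (pickP [pred z in S | (z != x) && (z != y)]) => [z /and3P[zS zx zy]|Sxy].
  exact: (dist_number_le_three rS xS yS zS).
have {}Sxy z : z \in S -> z = x \/ z = y.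
  move=> zS; have := Sxy z; rewrite /= zS /=.
  by case: eqP => [|_]; [left|case: eqP => //; right].
case: (boolP [exists a, exists b, [&& cedge a b, bare b & ~~ bare a]]).
  move=> /existsP[a /existsP[b /and3P[cab nb na]]].
  by apply: (dist_number_le_bare rS xS yS pxy cab).
move=> none; apply: (dist_number_le_dressed rS xS yS pxy Sxy) => a sa.
have [ps _] := projP v.
have nv : proj v \in [predC bare].
  by rewrite inE; apply/negP => /bareP/(_ v erefl) vs'; rewrite vs' in vs.
(* With no edge between a trivial and a nontrivial tree, nontriviality spreads from [proj v] around
   the cycle. *)
have cl : closed cedge [predC bare].
  apply: intro_closed; first exact: (sym_connect_sym cedge_sym).
  move=> u w cuw; rewrite !inE => nu; apply: contraNN none => nw.
  have {}nu : ~~ bare u by []; have {}nw : bare w by [].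
  by apply/existsP; exists u; apply/existsP; exists w; rewrite cuw nw.
by have := closed_connect cl (cedge_connect ps sa); rewrite nv => /esym.
Qed.

Lemma dist_number_le_long_cycle : 6 <= size s -> dist_number e <= metric_dim e.
Proof.
move=> n6; have [S <- rS] := metric_dimP e_conn.
have [x [y [xS yS pxy]]] := resolving_two rS.
have [m mS mp] := ex_missing_colour rS.
pose g u := if index u s \in [:: 0; 1; 3] then x else y.
have gS u : g u \in S by rewrite /g; case: ifP.
apply: (colour_dist_number rS gS mS mp) => f af gf _.
have /hasP[a0 _ _] : has predT s by rewrite has_predT; lia.
pose a i := nth a0 s i; pose h i := index (f (a i)) s.
have a_s i : i < 6 -> a i \in s by move=> i6; apply: mem_nth (leq_trans i6 n6).
have fas i : i < 6 -> f (a i) \in s by move=> i6; rewrite aut_mem_cycle // a_s.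
have ia i : i < 6 -> index (a i) s = i.
  by move=> i6; apply: index_uniq (leq_trans i6 n6) _.
have fa_inj : {in gtn 6 &, injective h}.
  move=> i j i6 j6 /(index_inj a0 (fas i i6) (fas j j6))/perm_inj aij.
  by rewrite -(ia i i6) aij ia.
have adj i : i < 5 -> cedge (a i) (a i.+1).
  move=> i5; have i6 : i < 6 := leqW i5.
  by rewrite cedge_index ?a_s // !ia // /cyclic_adj eqxx.
have hadj i : i < 5 -> cyclic_adj (size s) (h i) (h i.+1).
  move=> i5; have i6 : i < 6 := leqW i5.
  by rewrite -cedge_index ?fas // aut_cedge // adj.
have hcol i : i < 6 -> i \in [:: 0; 1; 3] -> h i \in [:: 0; 1; 3].
  move=> i6 icol; have := gf _ (a_s i i6); rewrite /g -/(h i) ia // icol.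
  by case: ifP => // _ xy; rewrite xy eqxx in pxy.
have hfix i : i < 6 -> h i = i -> f (a i) = a i.
  by move=> i6 hi; apply: (index_inj a0 (fas i i6) (a_s i i6)); rewrite ia.
(* [h 0], ..., [h 3] is a simple path of positions whose entries 0, 1 and 3 are marked, so
   [cyclic_rigid] applies. *)
have [h0 h1] : h 0 = 0 /\ h 1 = 1.
  apply: (@cyclic_rigid (size s) _ _ (h 2) (h 3)) => //; try exact: hadj.
    by apply/allP; rewrite /= !hcol.
  rewrite (map_inj_in_uniq (s := iota 0 4)) // => i j.
  rewrite !mem_iota => /andP[_ i4] /andP[_ j4].
  by apply: fa_inj; [apply: leq_trans i4 _|apply: leq_trans j4 _].
by exists (a 0), (a 1); split; [exact: adj|exact: hfix|exact: hfix].
Qed.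

Lemma cycle_gisomorphic : (forall x, x \in s) -> gisomorphic (cycle_graph (size s)) e.
Proof.
move=> allS; have /hasP[x0 _ _] : has predT s by rewrite has_predT; lia.
have ltS x : index x s < size s by rewrite index_mem.
exists (fun i : 'I_(size s) => nth x0 s i); split.
  exists (fun x => Ordinal (ltS x)) => [i|x]; last exact: nth_index.
  by apply: val_inj; rewrite /= index_uniq.
move=> i j.
transitivity (cedge (nth x0 s i) (nth x0 s j)).
  by apply/idP/idP => [exy|/cedge_sub//]; apply: edge_cedge.
by rewrite cedge_index // !index_uniq // cycle_graphE // ltnW.
Qed.
End Unicyclic.

(** * Cycles of length at most 5 *)

Lemma resolving_adj (T : finType) (e : rel T) (S : {set T}) : gconnected e ->
  (forall x y, (forall z, z \in S -> (x == z) = (y == z) /\ e x z = e y z) -> x = y) ->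
  resolving e S.
Proof.
move=> e_conn h; apply/resolvingP => x y exy; apply: h => z zS.
have dz := exy z zS; have eq0 : (x == z) = (y == z).
  by rewrite -!(gdist_eq0 (e_conn _ z)) dz.
split=> //; have [xz|xz] := eqVneq x z.
  by move: eq0; rewrite xz eqxx => /esym/eqP->.
by rewrite -(gdist_eq1 (e_conn x z) xz) dz gdist_eq1 // -eq0.
Qed.

(** A failed search would return [#|T|.+1], so the bound says that it succeeded. *)
Lemma dist_number_colouring (T : finType) (e : rel T) : dist_number e <= #|T| ->
  exists c : T -> 'I_(dist_number e), distinguishing e c.
Proof.
pose P k := [exists c : {ffun T -> 'I_k}, distinguishing e c].
rewrite -ltnS -{1}(size_iota 0 #|T|.+1) -[dist_number e]/(find P _) -has_find => hP.
have := nth_find 0 hP; rewrite nth_iota; last by have := hP; rewrite has_find size_iota.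
by case/existsP => c; exists c.
Qed.

(** One of the two classes has at most two elements; if they are [u] and [v], the value [r = u + v]
    modulo [n] swaps them. The proof checks all cases. Adding [n] prevents truncated subtraction. *)
Lemma small_cycle_reflection n (b : nat -> bool) : 2 < n <= 5 ->
  exists2 r, r < n & forall i, i < n -> b ((r + n - i) %% n) = b i.
Proof.
case/andP=> n2; move: n2; do 6?[case: n => [|n] //] => _ _;
  case b0: (b 0); case b1: (b 1); case b2: (b 2); case b3: (b 3); case b4: (b 4);
  by [ exists 0 => // -[|[|[|[|[|i]]]]] //; rewrite ?modnn ?b0 ?b1 ?b2 ?b3 ?b4
     | exists 1 => // -[|[|[|[|[|i]]]]] //; rewrite ?b0 ?b1 ?b2 ?b3 ?b4
     | exists 2 => // -[|[|[|[|[|i]]]]] //; rewrite ?b0 ?b1 ?b2 ?b3 ?b4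
     | exists 3 => // -[|[|[|[|[|i]]]]] //; rewrite ?b0 ?b1 ?b2 ?b3 ?b4
     | exists 4 => // -[|[|[|[|[|i]]]]] //; rewrite ?b0 ?b1 ?b2 ?b3 ?b4 ].
Qed.

Lemma small_cycle_resolving n i j : 2 < n <= 5 -> i < n -> j < n ->
  (i == 0) = (j == 0) -> (i == 1) = (j == 1) ->
  cyclic_adj n i 0 = cyclic_adj n j 0 -> cyclic_adj n i 1 = cyclic_adj n j 1 ->
  i = j.
Proof.
case/andP=> n2; move: n2; do 6?[case: n => [|n] //] => _ _;
  by case: i => [|[|[|[|[|i]]]]] // _; case: j => [|[|[|[|[|j]]]]].
Qed.

Section SmallCycle.
Variables (T : finType) (e : rel T) (n : nat) (f : 'I_n -> T) (f' : T -> 'I_n).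
Hypotheses (n_small : 2 < n <= 5) (fK : cancel f f') (f'K : cancel f' f).
Hypothesis f_iso : forall i j, e (f i) (f j) = cycle_graph n i j.

Lemma reflection_subproof r (i : 'I_n) : (r + n - i) %% n < n.
Proof. by rewrite ltn_pmod //; case/andP: n_small; lia. Qed.

Definition reflection r i := Ordinal (reflection_subproof r i).

(** A modulus-free description from which [lia] derives the later facts. *)
Lemma reflectionD r i : r < n ->
  (reflection r i + i == r) || (reflection r i + i == r + n).
Proof.
move=> ltrn /=; have := ltn_ord i; case: (leqP i r) => lir ltin.
  by rewrite -addnBAC // modnDr modn_small //; lia.
by rewrite modn_small //; lia.
Qed.

Lemma reflectionK r : r < n -> involutive (reflection r).
Proof.
move=> ltrn i; have := reflectionD i ltrn; have := reflectionD (reflection r i) ltrn.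
have := ltn_ord i; have := ltn_ord (reflection r (reflection r i)).
move: (reflection r i) => j; move: (reflection r j) => k; move: (ltn_ord j) => *.
by apply: ord_inj; lia.
Qed.

Lemma reflection_cycle_graph r i j : r < n ->
  cycle_graph n (reflection r i) (reflection r j) = cycle_graph n i j.
Proof.
move=> ltrn; have n1 : 1 < n by case/andP: n_small => /ltnW.
rewrite !cycle_graphE // /cyclic_adj.
have := reflectionD i ltrn; have := reflectionD j ltrn.
have := ltn_ord i; have := ltn_ord j.
move: (reflection r i) (reflection r j) => i' j'; have := ltn_ord i'; have := ltn_ord j'.
by lia.
Qed.

(** Fixing 0 forces [r = 0], and then fixing 1 would force 2 to be 0 or [n]. *)
Lemma reflection_neq r : r < n -> exists i, reflection r i != i.
Proof.
move=> ltrn; have n0 : 0 < n by lia. have n1 : 1 < n by lia.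
have [h0|] := eqVneq (reflection r (Ordinal n0)) (Ordinal n0); last
  by exists (Ordinal n0).
exists (Ordinal n1); apply/eqP => h1; have := reflectionD (Ordinal n0) ltrn.
have := reflectionD (Ordinal n1) ltrn; rewrite h0 h1 /=; lia.
Qed.

Lemma dist_number_small_cycle : 2 < dist_number e.
Proof.
have cT : #|T| = n.
  by rewrite -[RHS]card_ord; apply: esym; apply: bij_eq_card; exists f'.
rewrite ltnNge; apply/negP => D2.
have [|c /distinguishingP dc] := @dist_number_colouring _ e; first by lia.
(* With at most two colours, a colour is determined by whether it is 0. *)
pose b i := if insub i is Some j then c (f j) == 0 :> nat else false.
have [r ltrn br] := small_cycle_reflection b n_small.
pose p x := f (reflection r (f' x)).
have pinv : involutive p by move=> x; rewrite /p fK reflectionK.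
have [i ri] := reflection_neq ltrn.
have /(congr1 (fun q : {perm T} => q (f i))) : perm (inv_inj pinv) = 1%g.
  apply: dc => [|x].
    apply/forallP => x; apply/forallP => y; rewrite !permE /p f_iso.
    by rewrite reflection_cycle_graph // -f_iso !f'K.
  rewrite permE; apply: ord_inj.
  have := br (f' x) (ltn_ord _); rewrite /b -[_ %% _]/(val (reflection r (f' x))) !valK.
  rewrite -/(p x) f'K; have := ltn_ord (c x); have := ltn_ord (c (p x)).
  by move: (c (p x) : nat) (c x : nat) => u v; lia.
by rewrite permE perm1 /p fK => /(can_inj fK)/eqP; apply/negP.
Qed.

Lemma metric_dim_small_cycle : gconnected e -> metric_dim e <= 2.
Proof.
move=> e_conn; have n0 : 0 < n by lia. have n1 : 1 < n by lia.
pose o0 := Ordinal n0; pose o1 := Ordinal n1.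
apply: leq_trans (@metric_dim_le _ e [set f o0; f o1] _) _; last
  by rewrite cards2; case: eqP.
apply: resolving_adj => // x y h; rewrite -[x]f'K -[y]f'K; congr f.
have [] := h (f o0) (set21 _ _); have [] := h (f o1) (set22 _ _).
rewrite -[x]f'K -[y]f'K !f_iso !fK !(can_eq fK) => {h}.
move: (f' x) (f' y) => i j.
rewrite !cycle_graphE // -!val_eqE /= /cyclic_adj => h1 h2 h3 h4.
by apply: ord_inj; apply: (small_cycle_resolving n_small (ltn_ord i) (ltn_ord j)).
Qed.

End SmallCycle.

Theorem theorem3p3 (T : finType) (e : rel T)
  (e_sym : symmetric e) (e_irr : irreflexive e)
  (e_conn : gconnected e) (e_uni : unicyclic e) :
  dist_number e = metric_dim e + 1 <->
  (gisomorphic (cycle_graph 3) e \/ gisomorphic (cycle_graph 4) e \/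
   gisomorphic (cycle_graph 5) e).
Proof.
have [[s cs] uni] := e_uni; have us t (ct : is_cycle_seq e t) := uni t s ct cs.
split=> [D|iso].
  have allS x : x \in s.
    apply/negPn/negP => xs; have : dist_number e <= metric_dim e.
      by apply: (@dist_number_le_tree _ _ s) => //; exists x.
    by rewrite D addn1 ltnn.
  have n5 : size s <= 5.
    rewrite leqNgt; apply/negP => n6.
    have := @dist_number_le_long_cycle _ _ s e_sym e_irr e_conn cs us n6.
    by rewrite D addn1 ltnn.
  have := @cycle_gisomorphic _ _ s e_sym e_irr e_conn cs us allS.
  have /and3P[_ n2 _] := cs; move: n2 n5.
  by case: (size s) => [|[|[|[|[|[|k]]]]]] // _ _; auto.
have [n [n_small [f [[f' fK f'K] fiso]]]] :
    exists n, 2 < n <= 5 /\ gisomorphic (cycle_graph n) e.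
  by case: iso => [|[]]; [exists 3|exists 4|exists 5].
have s0 : T by case: s cs {us} => [/and3P[]|].
have d2 : 2 <= metric_dim e by apply: (@metric_dim_ge2 _ _ s).
(* The dimension is exactly 2, and the distinguishing number lies between 3 and the dimension plus
   one. *)
have := dist_number_small_cycle n_small fK f'K fiso.
have := metric_dim_small_cycle n_small fK f'K fiso e_conn.
have := dist_number_le_metric_dim e_conn s0; lia.
Qed.
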